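(* Let $[U,\mathcal K]\subseteq[\mathbb R^n,\mathcal K^\star]$, where $\mathcal K^\star$ is the collection of all convex subsets of $\mathbb R^n$. Consider any $P\in\mathcal K$ such that $P_I:=\operatorname{conv}(P)$ with respect to $\mathbb R^n$ is a full-dimensional polyhedron, and any relaxation $P'$ of $P$. Suppose we disallow all disjunctions in the branch-and-cut tree, i.e., we consider only pure cutting plane proofs (the certificates of validity of the cutting planes may contain disjunctions). Then $$\max\{\text{facet complexity of }P,\ f\}\ \le\ \text{hull complexity of }P\ \le\ f\,(\text{facet complexity of }P-1)+1,$$ where $f$ is the number of nontrivial facets of $P_I$, i.e., those facets that are not valid for the relaxation $P'$.
   Context: $[U,\mathcal K]\subseteq[\mathbb R^n,\mathcal K^\star]$ means that $U\subseteq\mathbb R^n$ and $\mathcal K=\{C\cap U:C\subseteq\mathbb R^n\text{ convex}\}$. A relaxation of $K\in\mathcal K$ is a convex set $K'\subseteq\mathbb R^n$ with $K'\cap U=K$ (and $K$ is the restriction of $K'$). A halfspace in $[\mathbb R^n,\mathcal K^\star]$ is a convex set $H\subseteq\mathbb R^n$ whose complement is also convex. It is a valid halfspace for $K\in\mathcal K$ if $K\subseteq H\cap U$. Here $P$ stands for a system $K_1,\dots,K_t\in\mathcal K$ with $P=K_1\cap\dots\cap K_t$, and $P'$ for a system of relaxations $K'_1,\dots,K'_t$ of these sets with $P'=K'_1\cap\dots\cap K'_t$. A certificate of infeasibility for a system of sets with empty intersection is a binary string that a fixed checking algorithm accepts in time polynomial in the lengths of the system and the string; every infeasible system has one and no feasible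 system does. Its size is its length. A pure cutting plane proof (a branch-and-cut tree in which no disjunctions are used) is a rooted tree in which each node has two labels. The first label is a list $\mathcal L$ of convex sets in $\mathbb R^n$. The second label of an internal node with list $\mathcal L$ is a valid halfspace $G'$ (a cutting plane) for the intersection of $U$ with all sets in $\mathcal L$, and the node has two children: the right child has first label $\mathcal L\cup\{G'\}$, and the left child is a leaf, called a cutting plane certifier, whose second label is a certificate of infeasibility (the certificate of validity of the cutting plane) for the system consisting of the restrictions of the sets in $\mathcal L$ together with $U\setminus G'$. The second label of any other leaf may be empty or hold a certificate of infeasibility. The size of the tree is its total number of nodes plus the sum of the sizes of all infeasibility certificates provided at the nodes with valid halfspaces. One can restrict the family of valid halfspaces that may be used (the cutting plane paradigm); all complexities are relative to this choice, and a complexity is $+\infty$ if no tree of the required kind exists. Complexities are assumed finite for simplicity (in the infinite case the inequalities are regarded as trivial). The hull complexity of $P$ (with respect to $K'_1,\dots,K'_t$) is the smallest size of such a tree whose root has first label $\{K'_1,\dots,K'_t\}$ and such that for every leaf the intersection of the sets in the first label of the leaf is contained in $\operatorname{conv}(P)$. For a valid halfspace $H'$ for $P$, the validity complexity of $H'$ is the smallest size of such a tree whose root has first label $\{K'_1,\dots,K'_t\}$ and such that for every leaf the intersection of the sets in the first label of the leaf is contained in $H'$. The validity complexity of a facet of $\operatorname{conv}(P)$ is the minimum of the validity complexities of all halfspaces that define that facet. The facet complexity of $P$ (with respect to $P'$) is the maximum validity complexity of all facets of $\operatorname{conv}(P)$.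
   Formalization: Added assumption: a certificate of infeasibility for a system remains one after another set is inserted. Without it the upper bound fails, e.g. for a checker demanding a fixed number of padding bits per set of the system. *)

(* Defs.v *)
From mathcomp Require Export all_boot all_order all_algebra finmap.
From mathcomp Require Export all_classical all_reals all_analysis.
Export Order.TTheory GRing.Theory Num.Theory.
Set Implicit Arguments.
Unset Strict Implicit.
Unset Printing Implicit Defensive.
Local Open Scope classical_set_scope.
Local Open Scope ring_scope.

Section Geometry.
Variables (R : realType) (n : nat).
Local Notation V := 'rV[R]_n.
Implicit Types (A C F H P Q : set V).

Definition convex C : Prop := @convex_set R V C.

Definition convex_hull A : set V := smallest convex A.

Definition polyhedron Q : Prop :=
  exists (m : nat) (A : 'M[R]_(n, m)) (b : 'rV[R]_m),
    Q = [set x : V | forall j, (x *m A) 0 j <= b 0 j].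

(* [A] contains [d.+1] affinely independent points. *)
Definition dim_ge A (d : nat) : Prop :=
  exists (x : V) (M : 'M[R]_(d, n)),
    [/\ A x, row_free M & forall i, A (x + row i M)].

(* The affine hull of [A] (nonempty) has dimension exactly [d]. *)
Definition has_dim A (d : nat) : Prop := dim_ge A d /\ ~ dim_ge A d.+1.

Definition full_dimensional A : Prop := has_dim A n.

Definition face Q F : Prop :=
  exists (a : 'cV[R]_n) (b : R),
    (forall x, Q x -> (x *m a) 0 0 <= b) /\
    F = Q `&` [set x : V | (x *m a) 0 0 = b].

Definition facet Q F : Prop :=
  face Q F /\ exists d, has_dim Q d.+1 /\ has_dim F d.

(* A halfspace need be neither open nor closed. *)
Definition halfspace H : Prop := convex H /\ convex (~` H).

(* [H] lies between the open and the closed side of a hyperplane that cuts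
   [F] out of [Q]. When [F] is a facet of a full-dimensional [Q], this
   hyperplane is the one spanned by [F]; the halfspaces defining [F] differ
   only in which points of the hyperplane they contain. *)
Definition defines_face Q F H : Prop :=
  exists (a : 'cV[R]_n) (b : R),
    [/\ [set x : V | (x *m a) 0 0 < b] `<=` H,
        H `<=` [set x : V | (x *m a) 0 0 <= b] &
        F = Q `&` [set x : V | (x *m a) 0 0 = b]].

Definition inter (L : seq (set V)) : set V := \big[setI/setT]_(C <- L) C.

End Geometry.

Section CuttingPlanes.
Variables (R : realType) (n : nat).
Local Notation V := 'rV[R]_n.
Variable U : set V.
Implicit Types (C G H K P : set V) (L S : seq (set V)).

Definition in_family K : Prop := exists2 C, convex C & K = C `&` U.

Definition relaxation K K' : Prop := convex K' /\ K' `&` U = K.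

Definition valid_halfspace K H : Prop := halfspace H /\ K `<=` H `&` U.

Definition restrictions L : seq (set V) := [seq C `&` U | C <- L].

(* The checking algorithm is an arbitrary predicate with an arbitrary length
   of systems and an arbitrary running time, since neither an encoding of
   convex sets nor a machine model is fixed.
   [accepts_add]: a certificate for a system remains one after a set is
   inserted. *)
Record certification := Certification {
  accepts : seq (set V) -> bitseq -> bool;
  system_length : seq (set V) -> nat;
  running_time : seq (set V) -> bitseq -> nat;
  accepts_poly : exists k : nat, forall S c, accepts S c ->
    (running_time S c <= k * (system_length S + size c) ^ k + k)%N;
  accepts_complete : forall S, (forall K, K \in S -> in_family K) ->
    inter S = set0 -> exists c, accepts S c;
  accepts_sound : forall S, (forall K, K \in S -> in_family K) ->
    forall c, accepts S c -> inter S = set0;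
  accepts_add : forall S1 K S2,
    (forall K0, K0 \in S1 ++ K :: S2 -> in_family K0) ->
    forall c, accepts (S1 ++ S2) c -> accepts (S1 ++ K :: S2) c
}.

(* [allowed L G]: the halfspace [G] may be used at a node with first label
   [L]. A restriction that does not depend on [L] trivially satisfies
   [allowed_add]. *)
Record paradigm := Paradigm {
  allowed : seq (set V) -> set (set V);
  allowed_add : forall L1 C L2, convex C ->
    forall G, allowed (L1 ++ L2) G -> allowed (L1 ++ C :: L2) G
}.

(* [CPNode G c T] is an internal node with second label [G], whose left child
   is the cutting plane certifier with second label [c] and whose right child
   is [T]; [CPLeaf] is a leaf that is not a certifier, with its second label.
   First labels are not stored: that of the root is given, and the others
   follow from it. *)
Inductive cp_tree :=
| CPLeaf of option bitseq
| CPNode of set V & bitseq & cp_tree.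

(* An internal node counts together with its certifier. *)
Fixpoint cp_size (T : cp_tree) : nat :=
  match T with
  | CPLeaf _ => 1
  | CPNode _ c T' => 2 + size c + cp_size T'
  end.

Section Complexity.
Variables (X : certification) (CP : paradigm).

Fixpoint cp_proof L (T : cp_tree) : Prop :=
  match T with
  | CPLeaf None => True
  | CPLeaf (Some c) => accepts X (restrictions L) c
  | CPNode G c T' =>
      [/\ valid_halfspace (U `&` inter L) G, allowed CP L G,
          accepts X (rcons (restrictions L) (U `\` G)) c &
          cp_proof (rcons L G) T']
  end.

(* First label of the only leaf that is not a certifier. The containment
   required of the leaves concerns this leaf only: certifiers have no list of
   their own, and their part is played by the certificate they hold. *)
Fixpoint leaf_label L (T : cp_tree) : seq (set V) :=
  match T with
  | CPLeaf _ => L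
  | CPNode G _ T' => leaf_label (rcons L G) T'
  end.

(* Smallest size of a proof that [inter L] can be cut down to a subset of [Q];
   [+oo] if there is none. *)
Definition cp_complexity L (Q : set V) : \bar R :=
  ereal_inf [set ((cp_size T)%:R)%:E
            | T in [set T | cp_proof L T /\ inter (leaf_label L T) `<=` Q]].

Definition hull_complexity P L : \bar R := cp_complexity L (convex_hull P).

Definition validity_complexity L H : \bar R := cp_complexity L H.

Definition defines_facet P F H : Prop :=
  valid_halfspace P H /\ defines_face (convex_hull P) F H.

Definition facet_validity_complexity P L (F : set V) : \bar R :=
  ereal_inf [set validity_complexity L H | H in [set H | defines_facet P F H]].

Definition facet_complexity P L : \bar R :=
  ereal_sup [set facet_validity_complexity P L F
            | F in [set F | facet (convex_hull P) F]].

End Complexity.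

Definition nontrivial_facets P (P' : set V) : set (set V) :=
  [set F | facet (convex_hull P) F /\
           ~ exists2 H, defines_facet P F H & P' `<=` H].

Definition num_nontrivial_facets P (P' : set V) : nat :=
  #|` fset_set (nontrivial_facets P P')|.

End CuttingPlanes.

(* Main.v *)
(** A full-dimensional polyhedron [Q = conv P] has an irredundant description by
finitely many inequalities, one per facet, and each of them has a point that is
tight for it and strict for all others.

Lower bounds: the tree of a hull proof proves every facet-defining closed
halfspace.  Moreover, at such a point of a nontrivial facet one can leave [Q]
while staying in the relaxation; some cut of the tree must exclude the beginning
of this segment, and then its boundary hyperplane is that of the facet.  A cut
bounds at most one facet, so there are at least as many cuts as nontrivial
facets.

Upper bound: grafting optimal validity proofs of the nontrivial facets onto one
another, each adding its size minus one, gives a hull proof, because the trivial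
facets are valid for the relaxation already. *)
Require Import Defs.
From mathcomp Require Import ring lra zify.
Set Implicit Arguments.
Unset Strict Implicit.
Unset Printing Implicit Defensive.
Local Open Scope classical_set_scope.
Local Open Scope ring_scope.

Local Notation "x ** a" := ((x *m a) 0 0) (at level 40).

(** * Convexity, affine dimension and linear algebra *)

Section Polyhedra.
Variables (R : realType) (n : nat).
Local Notation V := 'rV[R]_n.
Implicit Types (x y z v w p : V) (Q F G H P : set V).

Lemma dotD x y (a : 'cV[R]_n) : (x + y) ** a = x ** a + y ** a.
Proof. by rewrite mulmxDl mxE. Qed.

Lemma dotZ s x (a : 'cV[R]_n) : (s *: x) ** a = s * (x ** a).
Proof. by rewrite -scalemxAl mxE. Qed.

Lemma dotN x (a : 'cV[R]_n) : (- x) ** a = - (x ** a).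
Proof. by rewrite mulNmx mxE. Qed.

Lemma dotZr s x (a : 'cV[R]_n) : x ** (s *: a) = s * (x ** a).
Proof. by rewrite -scalemxAr mxE. Qed.

Definition dotE := (dotD, dotZ, dotN).

Lemma convexP G : convex G <->
  forall x y (s : R), G x -> G y -> 0 <= s <= 1 -> G (x + s *: (y - x)).
Proof.
have E x y (l : {i01 R}) :
    @conv R (convex_lmodType V) l x y = y + l%:num *: (x - y).
  rewrite [LHS](_ : _ = l%:num *: x + (1 - l%:num) *: y) //.
  by rewrite scalerBl scale1r scalerBr addrC addrAC -addrA.
split=> [cG x y s Gx Gy /andP[s0 s1]|cG x y l].
  have := cG y x (Itv01 s0 s1); rewrite !inE => /(_ Gy Gx).
  by rewrite E.
by rewrite !inE => Gx Gy; rewrite E; apply: cG => //; apply/andP; split.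
Qed.

Lemma convex_lt (a : 'cV[R]_n) b : convex [set x : V | x ** a < b].
Proof.
apply/convexP => x y s /= xb yb /andP[s0 s1]; rewrite !dotE.
have [->|sn0] := eqVneq s 0; first by lra.
have : 0 < s by rewrite lt_def sn0.
nra.
Qed.

Lemma convex_le (a : 'cV[R]_n) b : convex [set x : V | x ** a <= b].
Proof. by apply/convexP => x y s /= xb yb /andP[s0 s1]; rewrite !dotE; nra. Qed.

Lemma halfspace_le (a : 'cV[R]_n) b : halfspace [set x : V | x ** a <= b].
Proof.
split; first exact: convex_le.
suff -> : ~` [set x : V | x ** a <= b] = [set x | x ** (- a) < - b].
  exact: convex_lt.
have e x : x ** (- a) = - (x ** a) by rewrite mulmxN mxE.
by apply/seteqP; split=> x /=; rewrite e ltrN2 ltNge => /negP.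
Qed.

Lemma sub_hull P C : convex C -> P `<=` C -> convex_hull P `<=` C.
Proof. exact: smallest_sub. Qed.

Lemma hull_sub P : P `<=` convex_hull P.
Proof. exact: sub_smallest. Qed.

(** One step length serves all strict inequalities: the inverse of one plus the sum of the ratios
    [|d i| / c i]. It also covers an empty [I]. *)
Lemma small_step (I : finType) (c d : I -> R) : (forall i, 0 < c i) ->
  exists2 e : R, 0 < e <= 1 & forall t : R, 0 <= t <= e -> forall i, t * d i < c i.
Proof.
move=> c0; pose S := \sum_i `|d i| / c i.
have S0 : 0 <= S by apply: sumr_ge0 => i _; rewrite divr_ge0 // ltW.
have S1 : 0 < 1 + S by lra.
exists (1 + S)^-1; first by rewrite invr_gt0 S1 invf_le1 //= lerDl.
move=> t /andP[t0 te] i.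
have dS : `|d i| / c i <= S.
  rewrite /S (bigD1 i) //= lerDl; apply: sumr_ge0 => j _.
  by rewrite divr_ge0 // ltW.
have tS : t * (1 + S) <= 1 by rewrite -ler_pdivlMr // div1r.
have dc : `|d i| <= S * c i by rewrite -ler_pdivrMr.
have [->|tn0] := eqVneq t 0; first by rewrite mul0r.
have tgt : 0 < t by rewrite lt_def tn0.
apply: (@le_lt_trans _ _ (t * S * c i)).
  by rewrite -mulrA ler_pM2l // (le_trans (ler_norm _)).
by rewrite gtr_pMl //; lra.
Qed.

Lemma dim_geD Q d k : dim_ge Q (d + k) -> dim_ge Q d.
Proof.
move=> [x [M [Qx Mf MQ]]]; exists x, (usubmx M); split => //; last first.
  by move=> i; rewrite row_usubmx; apply: MQ.
apply/inj_row_free => v v0.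
have: row_mx v (0 : 'rV_k) *m M = 0 *m M.
  by rewrite -[M]vsubmxK mul_row_col v0 !mul0mx addr0.
by move/(row_free_inj Mf)/eqP; rewrite row_mx_eq0 => /andP[/eqP].
Qed.

Lemma dim_ge_le Q d d' : (d <= d')%N -> dim_ge Q d' -> dim_ge Q d.
Proof. by move=> /subnKC <-; apply: dim_geD. Qed.

Lemma has_dim_inj Q d d' : has_dim Q d -> has_dim Q d' -> d = d'.
Proof.
move=> [Qd nQd] [Qd' nQd']; have [dd'|dd'|//] := ltngtP d d'.
  by case: nQd; apply: dim_ge_le dd' _.
by case: nQd'; apply: dim_ge_le dd' _.
Qed.

Lemma row_free_mulmx_eq0 d (M : 'M[R]_(d, n)) (a : 'cV[R]_n) :
  row_free M -> d = n -> M *m a = 0 -> a = 0.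
Proof.
move=> Mf dn; subst d => Ma; have Mu : M \in unitmx by rewrite -row_free_unit.
by rewrite -(mulKmx Mu a) Ma mulmx0.
Qed.

(** By rank-nullity the column vectors killed by [M] form a line. *)
Lemma row_free_kernel_line d (M : 'M[R]_(d, n)) (a c : 'cV[R]_n) :
  row_free M -> d.+1 = n -> a != 0 -> M *m a = 0 -> M *m c = 0 ->
  exists l, c = l *: a.
Proof.
move=> Mf dn a0 Ma Mc.
have ker (u : 'cV[R]_n) : M *m u = 0 -> (u^T <= kermx M^T)%MS.
  by move=> Mu; apply/sub_kermxP; rewrite -trmx_mul Mu trmx0.
have rk : \rank (kermx M^T) = 1%N.
  by rewrite mxrank_ker mxrank_tr (eqP Mf) -dn subSnn.
have ra : \rank a^T = 1%N by rewrite rank_rV -trmx0 (inj_eq trmx_inj) a0.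
have [_] := mxrank_leqif_sup (ker _ Ma); rewrite ra rk eqxx => /esym sa.
have /sub_rVP[l e] := submx_trans (ker _ Mc) sa.
by exists l; apply: trmx_inj; rewrite e linearZ.
Qed.

Lemma dot_pos (a : 'cV[R]_n) : a != 0 -> exists v, 0 < v ** a.
Proof.
move=> a0; have [k ak] : exists k, a k 0 != 0.
  apply: contrapT => na; move/eqP: a0; apply; apply/matrixP => k j.
  rewrite [j]ord1 mxE; apply/eqP; apply: contrapT => /negP ak; apply: na.
  by exists k.
exists (a k 0 *: delta_mx 0 k); rewrite dotZ -rowE mxE -expr2.
by rewrite lt_def sqr_ge0 sqrf_eq0 ak.
Qed.

(** The mean of the [d.+1] points [x] and [x + row k M], the form in which [dim_ge] presents
    affinely independent points. *)
Definition barycenter d x (M : 'M[R]_(d, n)) : V :=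
  x + d.+1%:R^-1 *: \sum_k row k M.

Lemma row_dot d (M : 'M[R]_(d, n)) (c : 'cV[R]_n) k :
  row k M ** c = (M *m c) k 0.
Proof. by rewrite -row_mul mxE. Qed.

(** The slack at the barycenter is the mean of the nonnegative slacks at the points, so it vanishes
    only if each of them does. *)
Lemma barycenter_lt d x (M : 'M[R]_(d, n)) (c : 'cV[R]_n) e :
    x ** c <= e -> (forall k, (x + row k M) ** c <= e) ->
  barycenter x M ** c < e \/ x ** c = e /\ M *m c = 0.
Proof.
move=> xe Me; pose S := \sum_k (e - (x + row k M) ** c).
have S0 : 0 <= S by apply: sumr_ge0 => k _; rewrite subr_ge0.
have d1 : d.+1%:R != 0 :> R by rewrite pnatr_eq0.
have E : d.+1%:R * (e - barycenter x M ** c) = (e - x ** c) + S.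
  rewrite /barycenter !dotE mulmx_suml summxE mulrBr mulrDr mulVKf //.
  rewrite /S; under [in RHS]eq_bigr do rewrite dotD opprD addrA.
  rewrite sumrB sumr_const card_ord -mulr_natl -natr1.
  by ring.
have [|ge] := ltP (barycenter x M ** c) e; [by left|right].
have : d.+1%:R * (e - barycenter x M ** c) <= 0.
  by rewrite mulr_ge0_le0 ?subr_le0.
rewrite E => le0; have xE : x ** c = e by lra.
split=> //; apply/matrixP => k j; rewrite [j]ord1 -row_dot [RHS]mxE.
have /psumr_eq0P z0 : S = 0 by lra.
have : e - (x + row k M) ** c = 0 by apply: z0 => // l _; rewrite subr_ge0.
by rewrite dotD xE; lra.
Qed.

Lemma dot_col m x (A : 'M[R]_(n, m)) j : x ** col j A = (x *m A) 0 j.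
Proof. by rewrite !mxE; apply: eq_bigr => k _; rewrite mxE. Qed.

(* An inclusion-minimal subsystem of the given inequalities. *)
Lemma polyhedron_irredundant Q : polyhedron Q ->
  exists (I : finType) (a : I -> 'cV[R]_n) (b : I -> R),
    (forall x, Q x <-> forall i, x ** a i <= b i) /\
    forall i, exists2 y : V, b i < y ** a i &
                forall j, j != i -> y ** a j <= b j.
Proof.
move=> [m [A [b QE]]].
pose sys (J : {set 'I_m}) := `[< forall x, Q x <-> forall j, j \in J -> x ** col j A <= b 0 j >].
have sysT : sys [set: 'I_m]%SET.
  apply/asboolP => x; rewrite QE /=; split => xb j => [_|].
    by rewrite dot_col.
  by have := xb j (finset.in_setT _); rewrite dot_col.
have [J /minsetP[/asboolP sJ minJ] _] := minset_exists sysT.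
exists {j | j \in J}, (fun j => col (val j) A), (fun j => b 0 (val j)); split.
  move=> x; rewrite sJ; split=> [xb j|xb j jJ]; first exact: xb (valP j).
  exact: (xb (Sub j jJ)).
move=> [i iJ] /=; apply: contrapT => noy.
(* Without such a point the [i]-th inequality follows from the others, and dropping it contradicts
   the minimality of [J]. *)
have : sys (J :\ i)%SET.
  apply/asboolP => x; rewrite sJ; split=> [xb j /setD1P[_]|xb j jJ]; first exact: xb.
  have [->|ji] := eqVneq j i; last by apply: xb; rewrite !inE ji.
  rewrite leNgt; apply/negP => bx; apply: noy; exists x => // -[k kJ] ki.
  by apply: xb; rewrite !inE kJ andbT; apply: contraNneq ki => /= ki; apply/eqP/val_inj.
move=> /minJ/(_ (subD1set _ _)) e.
by have := iJ; rewrite -e !inE eqxx.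
Qed.

Lemma has_dim_point Q d : has_dim Q d -> exists x, Q x.
Proof. by move=> [[x [M [Qx _ _]]] _]; exists x. Qed.

(** * Facets of a full-dimensional polyhedron with irredundant inequalities *)

Section IrredundantSystem.
Variables (I : finType) (a : I -> 'cV[R]_n) (b : I -> R) (Q : set V).
Hypothesis QE : forall x, Q x <-> forall i, x ** a i <= b i.
Hypothesis irr : forall i, exists2 y : V, b i < y ** a i &
  forall j, j != i -> y ** a j <= b j.
Hypothesis fullQ : full_dimensional Q.

Definition cell i : set V := Q `&` [set x : V | x ** a i = b i].

Lemma constraint_neq0 i : a i != 0.
Proof.
have [x /QE/(_ i) xb] := has_dim_point fullQ; have [y + _] := irr i.
by apply: contraTneq => a0; move: xb; rewrite a0 !mulmx0 -leNgt.
Qed.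

(** Equality at the barycenter of [n.+1] affinely independent points would make a normal orthogonal
    to [n] independent directions, hence zero. *)
Lemma strict_point : exists p, forall i, p ** a i < b i.
Proof.
have [[x [M [Qx Mf MQ]]] _] := fullQ.
exists (barycenter x M) => i.
case: (@barycenter_lt _ x M (a i) (b i)) => [|k||[_ Ma]] //.
- by have /QE := Qx.
- by have /QE := MQ k.
by move/eqP: (constraint_neq0 i); case; apply: row_free_mulmx_eq0 Mf erefl Ma.
Qed.

(* The point where the segment from an interior point to a point violating only
   the [i]-th inequality leaves [Q]. *)
Lemma cell_point i : exists z, z ** a i = b i /\ forall j, j != i -> z ** a j < b j.
Proof.
have [p pb] := strict_point; have [y yi yj] := irr i.
have d0 : 0 < y ** a i - p ** a i by have := pb i; lra.
pose s := (b i - p ** a i) / (y ** a i - p ** a i).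
have sE : s * (y ** a i - p ** a i) = b i - p ** a i by rewrite divfK // gt_eqF.
have s0 : 0 < s by rewrite divr_gt0 // subr_gt0.
have s1 : s < 1 by rewrite ltr_pdivrMr //; lra.
exists (p + s *: (y - p)); split; first by rewrite !dotE sE; lra.
by move=> j ji; rewrite !dotE; have := pb j; have := yj _ ji; nra.
Qed.

Lemma cell_point_in i z :
  z ** a i = b i -> (forall j, j != i -> z ** a j < b j) -> Q z.
Proof.
move=> zi zj; apply/QE => j; have [->|ji] := eqVneq j i; first by rewrite zi.
exact/ltW/zj.
Qed.

Lemma cell_inj i j : cell i = cell j -> i = j.
Proof.
move=> e; have [z [zi zj]] := cell_point i.
have : cell i z by split=> //; exact: cell_point_in zi zj.
rewrite e => -[_ /= zb]; apply/eqP; rewrite eq_sym.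
by apply: contra_eqT zb => ji; rewrite lt_eqF // zj.
Qed.

Lemma cell_face i : face Q (cell i).
Proof. by exists (a i), (b i); split=> // x /QE. Qed.

(** Around a point strict for all other inequalities, a scaled-down basis of the kernel of [a i]
    stays in the face; [n] independent directions would force [a i] to be zero. *)
Lemma cell_facet i : facet Q (cell i).
Proof.
split; first exact: cell_face.
have [d dn] : exists d, d.+1 = n.
  case: {+}n (a i) (constraint_neq0 i) => [a0|d _ _]; last by exists d.
  by rewrite [a0]flatmx0 eqxx.
exists d; split; first by rewrite dn.
split; last first.
  move=> [x [M [[_ /= xi] Mf MF]]]; move/eqP: (constraint_neq0 i); apply.
  apply: (row_free_mulmx_eq0 Mf dn); apply/matrixP => k j.
  rewrite [j]ord1 -row_dot [RHS]mxE.
  by have [_ /=] := MF k; rewrite dotD; lra.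
have [M Mf Ma] : exists2 M : 'M[R]_(d, n), row_free M & M *m a i = 0.
  have rk : \rank (kermx (a i)) = d.
    rewrite mxrank_ker -mxrank_tr rank_rV -[X in _ != X]trmx0 (inj_eq trmx_inj).
    by rewrite constraint_neq0 -dn subSS subn0.
  exists (castmx (rk, erefl) (row_base (kermx (a i)))).
    by case: _ / rk; rewrite castmx_id row_base_free.
  case: _ / rk; rewrite castmx_id; apply/sub_kermxP; first by rewrite eq_row_base.
have [z [zi zj]] := cell_point i.
(* The [i]-th slack is zero, but the rows of [M] do not change it, so any positive value such as 1
   does there. *)
pose c (jk : I * 'I_d) := if jk.1 == i then 1 else b jk.1 - z ** a jk.1.
have [jk|e /andP[e0 _] eP] := @small_step _ c (fun jk => row jk.2 M ** a jk.1).
  by rewrite /c; case: eqVneq => // ji; rewrite subr_gt0 zj.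
exists z, (e *: M); split.
- by split=> //; exact: cell_point_in zi zj.
- by rewrite /row_free mxrank_scale_nz; [exact: Mf|rewrite gt_eqF].
move=> k; rewrite linearZ.
have Mi : row k M ** a i = 0 by rewrite row_dot Ma mxE.
split; last by rewrite /= !dotE Mi mulr0 addr0.
apply/QE => j; rewrite !dotE; have [->|ji] := eqVneq j i.
  by rewrite Mi mulr0 addr0 zi.
have := eP e _ (j, k); rewrite /c /= (negbTE ji) ltW // lexx => /(_ isT).
by lra.
Qed.

(** Some given inequality is tight on points spanning [F]. Its normal and [a0] are both orthogonal
    to [n - 1] independent directions, hence proportional; an interior point fixes the sign of the
    factor. *)
Lemma facet_constraint F (a0 : 'cV[R]_n) b0 : facet Q F -> (forall x, Q x -> x ** a0 <= b0) ->
  F = Q `&` [set x : V | x ** a0 = b0] ->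
  exists i (l : R), 0 < l /\ forall x : V, x ** a i - b i = l * (x ** a0 - b0).
Proof.
move=> [_ [d [Qd Fd]]] Qle FE; have dn := has_dim_inj Qd fullQ.
have a00 : a0 != 0.
  (* With a zero normal the face would be all of [Q], whose dimension is one more than that of
     [F]. *)
  apply/eqP => a00; have [y] := has_dim_point Fd.
  rewrite {1}FE a00 /= mulmx0 mxE => -[Qy b00].
  have FQ : F = Q.
    by rewrite FE a00 -b00; apply/seteqP; split=> x; [case|rewrite /= mulmx0 mxE].
  by rewrite FQ in Fd; have /eqP := has_dim_inj Qd Fd; rewrite eqn_leq ltnn.
have [[x [M [Fx Mf MF]]] _] := Fd.
have Fb y : F y -> y ** a0 = b0 by rewrite FE => -[].
have FQ y : F y -> Q y by rewrite FE => -[].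
have Ma0 : M *m a0 = 0.
  apply/matrixP => k j; rewrite [j]ord1 -row_dot [RHS]mxE.
  by have := Fb _ (MF k); rewrite dotD Fb //; lra.
(* Otherwise the barycenter of the points of [F] is interior to [Q]. *)
have [i [xi Mai]] : exists i, x ** a i = b i /\ M *m a i = 0.
  apply: contrapT => nt; pose q := barycenter x M.
  have qb i : 0 < b i - q ** a i.
    rewrite subr_gt0; case: (@barycenter_lt _ x M (a i) (b i)) => [|k||xM] //.
    - by have /QE := FQ _ Fx.
    - by have /QE := FQ _ (MF k).
    - by case: nt; exists i.
  have [v v0] := dot_pos a00.
  have [e /andP[e0 _] eP] := @small_step _ _ (fun i => v ** a i) qb.
  have : Q (q + e *: v).
    apply/QE => i; have := eP e _ i; rewrite lexx ltW // => /(_ isT).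
    by rewrite dotD dotZ; lra.
  have q0 : q ** a0 = b0.
    rewrite !dotE mulmx_suml summxE big1 ?mulr0 ?addr0 ?Fb // => k _.
    by rewrite row_dot Ma0 mxE.
  by move/Qle; rewrite dotD dotZ q0; nra.
have [p pb] := strict_point.
have [l lE] := row_free_kernel_line Mf dn a00 Ma0 Mai.
have E y : y ** a i - b i = l * (y ** a0 - b0).
  by rewrite -xi -(Fb _ Fx) lE !dotZr mulrBr.
exists i, l; split=> //.
have := pb i; have := E p; have : p ** a0 <= b0 by apply: Qle; apply/QE => k; apply/ltW.
by nra.
Qed.

Lemma facet_cell F : facet Q F -> exists i, F = cell i.
Proof.
move=> fF; have [[a0 [b0 [Qle FE]]] _] := fF.
have [i [l [l0 E]]] := facet_constraint fF Qle FE; exists i.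
rewrite FE; apply/seteqP; split=> x [Qx /= xb]; split=> //=; have := E x; nra.
Qed.

Definition bounds i H : Prop :=
  [set x : V | x ** a i < b i] `<=` H /\ H `<=` [set x : V | x ** a i <= b i].

Lemma bounds_defines_face i H : bounds i H -> defines_face Q (cell i) H.
Proof. by move=> [ltH Hle]; exists (a i), (b i). Qed.

(** The hyperplane in [defines_face] is existential; [facet_constraint] makes it that of some
    inequality [j], and [cell_inj] gives [j = i]. *)
Lemma defines_face_bounds i H :
  Q `<=` H -> defines_face Q (cell i) H -> bounds i H.
Proof.
move=> QH [a0 [b0 [ltH Hle FE]]].
have [j [l [l0 E]]] := facet_constraint (cell_facet i) (fun x Qx => Hle _ (QH _ Qx)) FE.
have <- : j = i.
  apply: cell_inj; rewrite FE; apply/seteqP.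
  by split=> x [Qx /= xb]; split=> //=; have := E x; nra.
split=> x /= => [xb|/Hle /= xb]; last by have := E x; nra.
by apply: ltH => /=; have := E x; nra.
Qed.

(** A point just beyond facet [i] can still be strict for inequality [j]: the latter puts it in [H],
    although it violates inequality [i]. *)
Lemma bounds_inj i j H : bounds i H -> bounds j H -> i = j.
Proof.
move=> [_ Hle] [ltH _]; apply/eqP; apply: contrapT => /negP ij.
have [z [zi zj]] := cell_point i; have [v v0] := dot_pos (constraint_neq0 i).
have zb : 0 < b j - z ** a j by rewrite subr_gt0 zj // eq_sym.
have [e /andP[e0 _] eP] := @small_step unit (fun=> b j - z ** a j)
  (fun=> v ** a j) (fun=> zb).
have /= := eP e _ tt; rewrite lexx ltW // => /(_ isT) lte.
have /Hle /= : H (z + e *: v) by apply: ltH; rewrite /= !dotE; lra.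
by rewrite !dotE zi; nra.
Qed.

(** A short step from [z] in the inward direction [w] reaches the interior of [Q], from where every
    direction [v] is open. *)
Lemma cell_half_ball i z w : z ** a i = b i ->
    (forall j, j != i -> z ** a j < b j) -> w ** a i < 0 ->
  exists2 s, 0 < s <= 1 &
    forall v, exists2 t, 0 < t <= 1 & Q (z + s *: w + t *: v).
Proof.
move=> zi zj wi.
pose c j := if j == i then 1 else b j - z ** a j.
have [j|s /andP[s0 s1] sP] := @small_step _ c (fun j => w ** a j).
  by rewrite /c; case: eqVneq => // ji; rewrite subr_gt0 zj.
have inner j : 0 < b j - (z + s *: w) ** a j.
  rewrite !dotE; have [->|ji] := eqVneq j i; first by rewrite zi; nra.
  have := sP s _ j; rewrite /c /= (negbTE ji) lexx ltW // => /(_ isT).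
  by lra.
exists s; first by rewrite s0.
move=> v; have [t t01 tP] := @small_step _ _ (fun j => v ** a j) inner.
exists t => //; apply/QE => j; have := tP t _ j.
case/andP: t01 => t0 _; rewrite lexx ltW // => /(_ isT).
by rewrite !dotE; lra.
Qed.

(* A point on the wrong side of [G] would, together with a point of the half
   ball in [Q] around [z], put [z + t *: v] on the wrong side as well. *)
Lemma halfspace_bounds i z v G : z ** a i = b i ->
    (forall j, j != i -> z ** a j < b j) ->
    halfspace G -> Q `<=` G ->
    (forall t, 0 < t <= 1 -> ~ G (z + t *: v)) -> bounds i G.
Proof.
move=> zi zj [/convexP cG /convexP cGC] QG nG; split=> x /= xb.
  apply: contrapT => nGx.
  have wi : (x - z) ** a i < 0 by rewrite !dotE zi; lra.
  (* The factor [1 - s] turns the point of [Q] into a convex combination of [z + t *: v] and [x],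
     with weight [s] on [x]. *)
  have [s /andP[s0 s1] /(_ ((1 - s) *: v))[t t01 Qy]] := cell_half_ball zi zj wi.
  have /= := cGC _ _ s (nG _ t01) nGx.
  rewrite (ltW s0) s1 => /(_ isT); apply; apply: QG.
  by congr Q: Qy; apply/rowP => k; rewrite !mxE; ring.
rewrite leNgt; apply/negP => bx.
have wi : (z - x) ** a i < 0 by rewrite !dotE zi; lra.
(* The factor [1 + s] puts [z + t *: v] on the segment from [x] to the point of [Q], at parameter
   [(1 + s)^-1]. *)
have [s /andP[s0 s1] /(_ ((1 + s) *: v))[t t01 Qy]] := cell_half_ball zi zj wi.
have s1' : 0 < 1 + s by lra.
apply: (nG _ t01).
have := cG _ _ (1 + s)^-1 xb (QG _ Qy).
rewrite invr_ge0 ltW // invf_le1 // lerDl ltW // => /(_ isT).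
by congr G; apply/rowP => k; rewrite !mxE; field; rewrite gt_eqF.
Qed.

End IrredundantSystem.

(** By convexity each set meets the segment in an initial interval. If none of these is reduced to
    [z], the least of finitely many parameters works for all sets. *)
Lemma segment_exit (Gs : seq (set V)) z v :
    (forall G, G \in Gs -> convex G /\ G z) ->
  (exists2 G, G \in Gs & forall t : R, 0 < t <= 1 -> ~ G (z + t *: v)) \/
  (exists2 t : R, 0 < t <= 1 & forall G, G \in Gs -> G (z + t *: v)).
Proof.
elim: Gs => [|G Gs IH] GsP; first by right; exists 1; rewrite ?ltr01 ?lexx.
have [[H HGs nH]|[t /andP[t0 t1] tP]] := IH (fun H HGs => GsP H (mem_behead (s := G :: Gs) HGs)).
  by left; exists H; rewrite // inE HGs orbT.
have [/convexP cG Gz] := GsP G (mem_head _ _).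
have [nG|] := pselect (forall t, 0 < t <= 1 -> ~ G (z + t *: v)).
  by left; exists G; rewrite ?mem_head.
move=> /existsNP[u /not_implyP[/andP[u0 u1] /contrapT Gu]].
right; exists (Num.min t u).
  by rewrite lt_min t0 u0 ge_min t1.
have shrink (H : set V) r r' : convex H -> H z -> H (z + r *: v) ->
    0 < r' <= r -> H (z + r' *: v).
  move=> /convexP cH Hz Hr /andP[r'0 r'r]; have r0 : 0 < r by lra.
  have := cH _ _ (r' / r) Hz Hr; rewrite divr_ge0 ?(ltW r0) ?(ltW r'0) //= ler_pdivrMr // mul1r r'r.
  by move=> /(_ isT); rewrite addrAC subrr add0r scalerA divfK ?gt_eqF.
move=> H; rewrite inE => /predU1P[->|HGs].
  by apply: (shrink _ u) => //; [exact/convexP|rewrite lt_min t0 u0 ge_min lexx orbT].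
have [cH Hz] := GsP H (mem_behead (s := G :: Gs) HGs).
by apply: (shrink _ t) => //; [exact: tP|rewrite lt_min t0 u0 ge_min lexx].
Qed.

End Polyhedra.

(** * Cuts, weakening and composition of cutting plane proofs *)

Section Trees.
Variables (R : realType) (n : nat) (U : set 'rV[R]_n).
Variables (X : certification U) (CP : paradigm R n).
Local Notation V := 'rV[R]_n.
Implicit Types (G H P : set V) (L M : seq (set V)) (T : cp_tree R n).

Lemma interP L x : inter L x <-> forall C, C \in L -> C x.
Proof.
rewrite /inter; elim: L => [|C L IH]; first by rewrite big_nil.
rewrite big_cons; split=> [[Cx /IH Lx] D|LCx].
  by rewrite inE => /predU1P[->|/Lx].
split; first by apply: LCx; rewrite mem_head.
by apply/IH => D DL; apply: LCx; rewrite inE DL orbT.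
Qed.

Fixpoint cuts T : seq (set V) :=
  if T is CPNode G _ T' then G :: cuts T' else [::].

Lemma leaf_labelE L T : leaf_label L T = L ++ cuts T.
Proof.
by elim: T L => [r|G c T IH] L /=; rewrite ?cats0 // IH cat_rcons.
Qed.

Lemma size_cuts T : (size (cuts T) < cp_size T)%N.
Proof. by elim: T => //= G c T; lia. Qed.

(** A cut is valid relative to the earlier cuts, but by induction those remove no point of [U] in
    [inter L]. *)
Lemma cp_proof_cuts L T : cp_proof X CP L T ->
  forall G, G \in cuts T -> halfspace G /\ U `&` inter L `<=` G.
Proof.
elim: T L => //= G c T IH L [[hG LG] _ _ /IH TP] H.
rewrite inE => /predU1P[->|/TP[hH LH]]; first by split=> // x /LG[].
split=> // x [Ux Lx]; apply: LH; split=> //; apply/interP => C.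
rewrite mem_rcons inE => /predU1P[->|]; first by have [] := LG x.
by move/interP: Lx; apply.
Qed.

(** More sets only shrink the intersection, so cuts stay valid; [accepts_add] and [allowed_add]
    preserve the rest. This lets a proof start at the leaf of another one. *)
Lemma cp_proof_insert L1 M L2 T : (forall C, C \in L1 ++ M ++ L2 -> convex C) ->
  cp_proof X CP (L1 ++ L2) T -> cp_proof X CP (L1 ++ M ++ L2) T.
Proof.
elim: M => //= C M IH cL TP.
have {TP} : cp_proof X CP (L1 ++ (M ++ L2)) T.
  apply: IH TP => D; rewrite mem_cat => DL; apply: cL.
  by rewrite mem_cat inE; case/orP: DL => ->; rewrite ?orbT.
move: {M L2 IH} (M ++ L2) cL => L2 cL.
have fam L : (forall D, D \in L -> convex D) ->
    forall K, K \in restrictions U L -> in_family U K.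
  by move=> cvL K /mapP[D DL ->]; exists D => //; apply: cvL.
have addE L1' L2' : restrictions U (L1' ++ L2') =
  restrictions U L1' ++ restrictions U L2' by rewrite /restrictions map_cat.
have insE L2' : restrictions U (L1 ++ C :: L2') =
  restrictions U L1 ++ (C `&` U) :: restrictions U L2' by rewrite addE.
elim: T L2 cL => [[c|] //=|G c T IH] L2 cL /=.
  by rewrite addE insE; apply: accepts_add; rewrite -insE; apply: fam.
move=> [[hG LG] aG cG TP]; split.
- split=> // x [Ux] /interP Lx; apply: LG; split=> //; apply/interP => D.
  by rewrite mem_cat => DL; apply: Lx; rewrite mem_cat inE; case/orP: DL => ->; rewrite ?orbT.
- by apply: allowed_add => //; apply: cL; rewrite mem_cat mem_head orbT.
- move: cG; rewrite addE insE !rcons_cat rcons_cons; apply: accepts_add.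
  rewrite -rcons_cons -rcons_cat -insE => K; rewrite mem_rcons inE.
  move=> /predU1P[->|]; last exact: fam.
  (* [U] minus [G] belongs to the family because the complement of a halfspace is convex. *)
  by exists (~` G); [case: hG|rewrite setIC].
- rewrite rcons_cat; apply: IH; last by rewrite -rcons_cat.
  move=> D; rewrite -rcons_cons -rcons_cat mem_rcons inE => /predU1P[->|]; last exact: cL.
  by case: hG.
Qed.

Fixpoint graft T T' : cp_tree R n :=
  if T is CPNode G c T1 then CPNode G c (graft T1 T') else T'.

Lemma cuts_graft T T' : cuts (graft T T') = cuts T ++ cuts T'.
Proof. by elim: T => //= G c T ->. Qed.

Lemma cp_size_graft T T' : (cp_size (graft T T')).+1 = (cp_size T + cp_size T')%N.
Proof. by elim: T => //= G c T IH; rewrite -addnS IH addnA. Qed.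

Lemma cp_proof_graft L T T' : cp_proof X CP L T ->
  cp_proof X CP (L ++ cuts T) T' -> cp_proof X CP L (graft T T').
Proof.
elim: T L => [r|G c T IH] L /=; first by rewrite cats0.
move=> [vG aG cG TP]; rewrite -cat_rcons => TP'; split=> //; exact: IH.
Qed.

(* Each grafting reuses the leaf of the first proof as the root of the second,
   so only [N.-1] nodes are added per halfspace. *)
Lemma cp_proof_combine L N (Hs : seq (set V)) : (forall C, C \in L -> convex C) ->
    (forall H, H \in Hs -> exists T, [/\ cp_proof X CP L T,
       inter (leaf_label L T) `<=` H & (cp_size T <= N)%N]) ->
  exists T, [/\ cp_proof X CP L T,
    forall H, H \in Hs -> inter (leaf_label L T) `<=` H &
    (cp_size T <= size Hs * N.-1 + 1)%N].
Proof.
move=> cL; elim: Hs => [|H Hs IH] HsP; first by exists (CPLeaf R n None).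
have [T [TP TH Tsz]] := IH (fun G GHs => HsP G (mem_behead (s := H :: Hs) GHs)).
have [T' [TP' TH' Tsz']] := HsP H (mem_head _ _).
exists (graft T T'); split.
- apply: cp_proof_graft => //.
  have := @cp_proof_insert L (cuts T) [::] T'; rewrite !cats0; apply=> // C.
  by rewrite mem_cat => /orP[/cL //|/(cp_proof_cuts TP)[[]]].
- move=> G; rewrite inE leaf_labelE cuts_graft => GH x /interP Lx.
  case/predU1P: GH => [->|/TH]; [apply: TH'|apply];
    rewrite leaf_labelE; apply/interP => C CL; apply: Lx; move: CL;
    by rewrite !mem_cat; case/orP=> ->; rewrite ?orbT.
- rewrite -ltnS cp_size_graft /= mulSn.
  (* A tree has positive size, which excludes [N = 0], where [N.-1] would not be [N - 1]. *)
  have : (0 < cp_size T')%N by case: (T') => //= ? c ?; rewrite addn_gt0.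
  by case: N Tsz Tsz' {HsP IH} => [|N] /=; [lia|move: (size Hs * N)%N; lia].
Qed.

Lemma cp_complexity_le L T Q : cp_proof X CP L T ->
  inter (leaf_label L T) `<=` Q -> (cp_complexity X CP L Q <= (cp_size T)%:R%:E)%E.
Proof. by move=> TP TQ; apply: ge_ereal_inf; exists (cp_size T)%:R%:E => //; exists T. Qed.

(** Every tree has a node. This keeps the facet complexity away from [-oo] once there is a facet. *)
Lemma facet_validity_complexity_ge1 P L F :
  (1 <= facet_validity_complexity X CP P L F)%E.
Proof.
apply/ereal_infP => _ [H _ <-]; apply/ereal_infP => _ [T _ <-].
by rewrite lee_fin ler1n; case: T => //= ? c ?; rewrite addn_gt0.
Qed.

(* The infimum is attained because sizes are natural numbers. *)
Lemma facet_validity_complexity_attained P L F (r : R) : 0 <= r ->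
    (facet_validity_complexity X CP P L F <= r%:E)%E ->
  exists H T, [/\ defines_facet U P F H, cp_proof X CP L T,
    inter (leaf_label L T) `<=` H & (cp_size T <= Num.trunc r)%N].
Proof.
move=> r0 fr; apply: contrapT => nT.
suff : ((Num.trunc r).+1%:R%:E <= facet_validity_complexity X CP P L F)%E.
  by move=> /le_trans/(_ fr); rewrite lee_fin leNgt truncnS_gt.
apply/ereal_infP => _ [H HF <-]; apply/ereal_infP => _ [T [TP TH] <-].
rewrite lee_fin ler_nat ltnNge; apply/negP => sz.
by apply: nT; exists H, T.
Qed.

End Trees.

(** * The lower and upper bounds on hull complexity *)

Section MainProof.
Variables (R : realType) (n : nat) (U : set 'rV[R]_n).
Variables (X : certification U) (CP : paradigm R n).
Local Notation V := 'rV[R]_n.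
Variables (P P' : set V) (L : seq (set V)).
Hypothesis LU : inter L `&` U = P.
Hypothesis LP' : P' = inter L.
Hypothesis convL : forall C, C \in L -> convex C.
Hypothesis PU : P `<=` U.
Variables (I : finType) (a : I -> 'cV[R]_n) (b : I -> R).
Let Q := convex_hull P.
Hypothesis QE : forall x, Q x <-> forall i, x ** a i <= b i.
Hypothesis irr : forall i, exists2 y : V, b i < y ** a i &
  forall j, j != i -> y ** a j <= b j.
Hypothesis fullQ : full_dimensional Q.
Let cell := cell a b Q.
Let S := nontrivial_facets U P P'.

Lemma defines_facetP i H :
  defines_facet U P (cell i) H <-> valid_halfspace U P H /\ bounds a b i H.
Proof.
split=> [[vH dH]|[vH bH]].
  split=> //; apply: (defines_face_bounds QE irr fullQ) dH.
  by case: vH => [[cH _] PH]; apply: sub_hull => // x /PH[].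
by split=> //; apply: bounds_defines_face.
Qed.

Lemma defines_facet_le i :
  defines_facet U P (cell i) [set x | x ** a i <= b i].
Proof.
apply/defines_facetP; split; last by split=> x //= /ltW.
split; first exact: halfspace_le.
by move=> x Px; split; [have /QE := hull_sub Px; exact|exact: PU].
Qed.

(** [fset_set] lists the elements of finite sets only, so counting facets depends on this. *)
Lemma finite_nontrivial : finite_set S.
Proof.
apply: (@sub_finite_set _ _ (range cell)); last exact: finite_image.
by move=> F [/(facet_cell QE irr fullQ)[i ->] _]; exists i.
Qed.

Lemma hull_sub_relaxation : Q `<=` inter L.
Proof.
apply: sub_hull; last by rewrite -LU => x [].
apply/convexP => x y s /interP Lx /interP Ly s01; apply/interP => C CL.
by have /convexP := convL CL; apply; [exact: Lx|exact: Ly|].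
Qed.

Lemma facet_complexity_le_hull :
  (facet_complexity X CP P L <= hull_complexity X CP P L)%E.
Proof.
apply/ereal_supP => _ [F /(facet_cell QE irr fullQ)[i ->] <-].
apply/ereal_infP => _ [T [TP TQ] <-].
apply: ge_ereal_inf; exists (validity_complexity X CP L [set x | x ** a i <= b i]).
  by exists [set x | x ** a i <= b i] => //; exact: defines_facet_le.
by apply: cp_complexity_le => // x /TQ/QE /(_ i).
Qed.

(* Leaving [Q] through the interior of a nontrivial facet while staying in the
   relaxation crosses a cut, which then defines that facet. *)
Lemma nontrivial_cut T F : cp_proof X CP L T ->
  inter (leaf_label L T) `<=` Q -> S F ->
  exists2 i, F = cell i & exists2 G, G \in cuts T & bounds a b i G.
Proof.
move=> TP TQ [/(facet_cell QE irr fullQ)[i ->] nt]; exists i => //.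
(* The closed halfspace defines the facet, so by nontriviality the relaxation must leave it. *)
have [y Ly yb] : exists2 y, inter L y & b i < y ** a i.
  apply: contrapT => ny; apply: nt; exists [set x | x ** a i <= b i].
    exact: defines_facet_le.
  rewrite LP' => x Lx /=; rewrite leNgt; apply/negP => bx; apply: ny.
  by exists x.
have [z [zi zj]] := cell_point QE irr fullQ i.
have Qz := cell_point_in QE zi zj.
have cutQ G : G \in cuts T -> halfspace G /\ Q `<=` G.
  move=> GT; have [hG LG] := cp_proof_cuts TP GT; split=> //.
  by apply: sub_hull; [case: hG|rewrite -LU setIC].
have [] := @segment_exit _ _ (cuts T) z (y - z).
- by move=> G /cutQ[[cG _] QG]; split=> //; apply: QG.
- move=> [G GT nG]; exists G => //; have [hG QG] := cutQ _ GT.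
  exact: (halfspace_bounds QE zi zj hG QG nG).
(* Otherwise a point of the segment survives all cuts and lies in the relaxation, hence in [Q], yet
   violates inequality [i]. *)
move=> [t /andP[t0 t1] tG].
have /TQ/QE/(_ i) : inter (leaf_label L T) (z + t *: (y - z)).
  rewrite leaf_labelE; apply/interP => C; rewrite mem_cat => /orP[CL|/tG //].
  have /convexP := convL CL; apply; last by rewrite t1 ltW.
    by have /interP := hull_sub_relaxation Qz; apply.
  by move/interP: Ly; apply.
by rewrite !dotE zi; nra.
Qed.

(** By [bounds_inj], choosing a cut for each nontrivial facet is injective. *)
Lemma num_facets_le_hull :
  ((num_nontrivial_facets U P P')%:R%:E <= hull_complexity X CP P L)%E.
Proof.
apply/ereal_infP => _ [T [TP TQ] <-]; rewrite lee_fin ler_nat.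
apply: leq_trans (ltnW (size_cuts T)).
have cutS F : exists G, S F ->
    exists2 i, F = cell i & G \in cuts T /\ bounds a b i G.
  have [/(nontrivial_cut TP TQ)[i Fi [G GT bG]]|] := pselect (S F).
    by exists G => _; exists i.
  by exists setT.
have [g gP] := choice cutS.
have inS F : F \in fset_set S -> S F.
  by rewrite in_fset_set; [rewrite inE|exact: finite_nontrivial].
rewrite /num_nontrivial_facets -/S -(size_map g (fset_set S)); apply: uniq_leq_size.
  rewrite map_inj_in_uniq ?fset_uniq // => F F' /inS/gP[i -> [_ bi]] /inS/gP[j -> [_ bj]].
  by move=> e; rewrite e in bi; rewrite (bounds_inj QE irr fullQ bi bj).
by move=> _ /mapP[F /inS/gP[i _ [GT _]] ->].
Qed.

Lemma hull_le_combined N : (forall F, S F -> exists H T,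
    [/\ defines_facet U P F H, cp_proof X CP L T,
      inter (leaf_label L T) `<=` H & (cp_size T <= N)%N]) ->
  (hull_complexity X CP P L <=
    (num_nontrivial_facets U P P' * N.-1 + 1)%:R%:E)%E.
Proof.
move=> SP.
have SP' F : exists H, S F -> exists T, [/\ defines_facet U P F H,
    cp_proof X CP L T, inter (leaf_label L T) `<=` H & (cp_size T <= N)%N].
  have [/SP[H HT]|] := pselect (S F); first by exists H.
  by exists setT.
have [h hP] := choice SP'.
have inS F : F \in fset_set S <-> S F.
  by rewrite in_fset_set; [rewrite inE|exact: finite_nontrivial].
have [|T [TP TH Tsz]] := @cp_proof_combine _ _ _ X CP L N (map h (fset_set S)) convL.
  by move=> _ /mapP[F /inS/hP[T [_ TP TH Tsz]] ->]; exists T.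
have TQ : inter (leaf_label L T) `<=` Q.
  move=> x Tx; apply/QE => i.
  have [/[dup] Si /hP[_ [/defines_facetP[_ [_ Hle]] _ _ _]]|nSi] := pselect (S (cell i)).
    by apply: Hle; apply: TH Tx; apply: map_f; apply/inS.
  have : exists2 H, defines_facet U P (cell i) H & P' `<=` H.
    by apply: contrapT => nH; apply: nSi; split=> //; exact: (cell_facet QE irr fullQ).
  move=> [H /defines_facetP[_ [_ Hle]] P'H]; apply/Hle/P'H; rewrite LP'.
  apply/interP => C CL; move/interP: Tx; apply.
  by rewrite leaf_labelE mem_cat CL.
apply: le_trans (cp_complexity_le TP TQ) _.
by rewrite lee_fin ler_nat; move: Tsz; rewrite size_map.
Qed.

Lemma hull_le : (hull_complexity X CP P L <=
  (num_nontrivial_facets U P P')%:R%:E * (facet_complexity X CP P L - 1) + 1)%E.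
Proof.
(* Without nontrivial facets the product is 0, even if the facet complexity is infinite, and a
   single leaf suffices. *)
have [f0|] := posnP (num_nontrivial_facets U P P').
  have := @hull_le_combined 0; rewrite f0 mul0e add0e; apply=> F SF.
  have /cardfs0_eq S0 := f0.
  by have := in_fset_set finite_nontrivial F; rewrite S0 !inE => /esym/negP; rewrite inE.
move=> fgt0.
have [F0 SF0] : exists F, S F.
  apply: contrapT => nS; move: fgt0; rewrite /num_nontrivial_facets -/S.
  rewrite (_ : S = set0) ?fset_set0 ?cardfs0 //.
  by apply/seteqP; split=> // F SF; case: nS; exists F.
have fv F : S F -> (facet_validity_complexity X CP P L F <= facet_complexity X CP P L)%E.
  by move=> [fF _]; apply: ereal_sup_ubound; exists F.
have fc1 : (1 <= facet_complexity X CP P L)%E.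
  exact: le_trans (facet_validity_complexity_ge1 _ _ _ _ _) (fv _ SF0).
case: (facet_complexity X CP P L) fv fc1 => [r| |] fv fc1 //; last first.
  (* At facet complexity [+oo] the right side is [+oo] too, since its factor is positive. *)
  by rewrite addye // gt0_muley ?addye ?leey // lte_fin ltr0n.
rewrite lee_fin in fc1; have r0 : 0 <= r by lra.
have := @hull_le_combined (Num.trunc r).
move=> /(_ (fun F SF => facet_validity_complexity_attained r0 (fv F SF))).
move/le_trans; apply; rewrite -EFinB -EFinM -EFinD lee_fin natrD natrM lerD2r.
apply: ler_wpM2l => //.
(* Positivity makes the predecessor of [Num.trunc r] a true subtraction, hence at most [r - 1]. *)
have t1 : (0 < Num.trunc r)%N by rewrite truncn_gt0.
by rewrite -subn1 natrB // lerB // truncn_le.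
Qed.

End MainProof.

Theorem theorem4p6 (R : realType) (n : nat) (U : set 'rV[R]_n)
    (X : certification U) (CP : paradigm R n)
    (t : nat) (K K' : 'I_t -> set 'rV[R]_n) (P P' : set 'rV[R]_n)
    (hK : forall i, in_family U (K i))
    (hK' : forall i, relaxation U (K i) (K' i))
    (hP : in_family U P) (hPK : P = \bigcap_i K i)
    (hP' : relaxation U P P') (hPK' : P' = \bigcap_i K' i)
    (hpoly : polyhedron (convex_hull P))
    (hfull : full_dimensional (convex_hull P)) :
  let L := [seq K' i | i <- enum 'I_t] in
  let f := ((num_nontrivial_facets U P P')%:R%:E : \bar R) in
  (maxe (facet_complexity X CP P L) f <= hull_complexity X CP P L)%E /\
  (hull_complexity X CP P L <= f * (facet_complexity X CP P L - 1) + 1)%E.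
Proof.
move=> L f.
have LP' : P' = inter L.
  rewrite hPK'; apply/seteqP; split=> x.
    by move=> K'x; apply/interP => _ /mapP[i _ ->]; apply: K'x.
  by move/interP => Lx i _; apply: Lx; rewrite map_f ?mem_enum.
have LU : inter L `&` U = P by rewrite -LP'; case: hP'.
have convL C : C \in L -> convex C by move=> /mapP[i _ ->]; case: (hK' i).
have PU : P `<=` U by case: hP => C _ -> x [].
have [I [a [b [QE irr]]]] := polyhedron_irredundant hpoly.
split; last exact: (hull_le X CP LP' convL QE irr hfull).
rewrite ge_max (facet_complexity_le_hull X CP L PU QE irr hfull).
exact: (num_facets_le_hull X CP LU LP' convL PU QE irr hfull).
Qed.
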